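(* There is no constant $t$ such that $\mathrm{SCR}(\mathrm{FRAC}(G)) \leq t$ for all graphs $G$.
   Context: Graphs $G = ([n],E)$ are finite, simple and undirected. $\mathrm{FRAC}(G)$ denotes the polyhedron $\{\mathbf{x} \in \mathbb{R}^n : x_i + x_j \leq 1 \ \forall \{i,j\} \in E,\ x_i \geq 0 \ \forall i \in [n]\}$, and $\mathrm{SCR}(\mathrm{FRAC}(G))$ is the small Chvátal rank of this inequality system, defined as follows. Let $\mathcal{A}_G := \{\mathbf{e}_i + \mathbf{e}_j : \{i,j\} \in E\} \cup \{-\mathbf{e}_i : i \in [n]\}$, where $\mathbf{e}_i$ is the $i$th standard unit vector. A basis in a set of vectors of $\mathbb{Z}^n$ is a subset of $n$ linearly independent vectors, and the cone generated by it is a basis cone. The minimal Hilbert basis of a pointed rational cone $K$ is the unique minimal finite set $H \subset K \cap \mathbb{Z}^n$ such that every element of $K \cap \mathbb{Z}^n$ is a nonnegative integer combination of elements of $H$. Set $\mathcal{A}_G^{(0)} = \mathcal{A}_G$, and for $k \geq 1$ let $\mathcal{A}_G^{(k)}$ be the union of the minimal Hilbert bases of all basis cones of $\mathcal{A}_G^{(k-1)}$. $\mathrm{SCR}(\mathrm{FRAC}(G))$ is the smallest $k$ such that there are integers $b'_{\mathbf{a}}$, $\mathbf{a} \in \mathcal{A}_G^{(k)}$, with $\mathrm{conv}(\mathrm{FRAC}(G) \cap \mathbb{Z}^n) = \{\mathbf{x} \in \mathbb{R}^n : \mathbf{a} \cdot \mathbf{x} \leq b'_{\mathbf{a}} \ \forall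 \mathbf{a} \in \mathcal{A}_G^{(k)}\}$. *)

(* Defs.v *)
From mathcomp Require Import all_boot all_order all_algebra.
From mathcomp Require Import finmap.
From mathcomp Require Import boolp classical_sets reals.

Set Implicit Arguments.
Unset Strict Implicit.
Unset Printing Implicit Defensive.

Import Order.TTheory GRing.Theory Num.Theory.
Local Open Scope classical_set_scope.
Local Open Scope ring_scope.

Record sgraph (n : nat) := SGraph {
  adj :> rel 'I_n;
  adj_sym : symmetric adj;
  adj_irr : irreflexive adj
}.

Definition intv (R : realType) (n : nat) (z : 'rV[int]_n) : 'rV[R]_n :=
  map_mx intr z.

Definition lattice_points (R : realType) (n : nat) : set 'rV[R]_n :=
  range (@intv R n).
Arguments lattice_points R n _ : clear implicits.

Definition dot (R : realType) (n : nat) (x y : 'rV[R]_n) : R :=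
  \sum_(i < n) x ord0 i * y ord0 i.

Definition conv (R : realType) (n : nat) (S : set 'rV[R]_n) : set 'rV[R]_n :=
  [set x : 'rV[R]_n | exists (m : nat) (p : 'I_m -> 'rV[R]_n) (w : 'I_m -> R),
     [/\ forall i, S (p i),
         forall i, 0 <= w i,
         \sum_(i < m) w i = 1 &
         x = \sum_(i < m) w i *: p i]].

(** A basis in [A] is given by an [n x n] integer matrix whose rows are its
    elements; being linearly independent, the rows are automatically distinct,
    and their order does not affect the cone they generate. *)
Definition basis_in (R : realType) (n : nat) (A : set 'rV[int]_n)
    (B : 'M[int]_n) : Prop :=
  (forall i, A (row i B)) /\ row_free (map_mx intr B : 'M[R]_n).

Definition basis_cone (R : realType) (n : nat) (B : 'M[int]_n) :
    set 'rV[R]_n :=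
  [set \sum_(i < n) c i *: intv R (row i B) | c in
     [set c : 'I_n -> R | forall i, 0 <= c i]].
Arguments basis_cone R {n} B _.

Definition hilbert_basis (R : realType) (n : nat) (K : set 'rV[R]_n)
    (H : {fset 'rV[int]_n}) : Prop :=
  (forall h, h \in H -> K (intv R h)) /\
  (forall z : 'rV[int]_n, K (intv R z) ->
     exists c : 'rV[int]_n -> nat, z = \sum_(h <- H) h *+ c h).

Definition minimal_hilbert_basis (R : realType) (n : nat) (K : set 'rV[R]_n)
    (H : {fset 'rV[int]_n}) : Prop :=
  hilbert_basis K H /\
  (forall H' : {fset 'rV[int]_n},
     hilbert_basis K H' -> (H' `<=` H)%fset -> H' = H).

Definition hilbert_step (R : realType) (n : nat) (A : set 'rV[int]_n) :
    set 'rV[int]_n :=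
  [set a : 'rV[int]_n | exists (B : 'M[int]_n) (H : {fset 'rV[int]_n}),
     [/\ basis_in R A B,
         minimal_hilbert_basis (basis_cone R B) H &
         a \in H]].
Arguments hilbert_step R {n} A _.

Definition unitv (n : nat) (i : 'I_n) : 'rV[int]_n := delta_mx ord0 i.

Definition frac_normals (n : nat) (G : sgraph n) : set 'rV[int]_n :=
  [set a : 'rV[int]_n | exists i j, G i j /\ a = unitv i + unitv j] `|`
  [set a : 'rV[int]_n | exists i, a = - unitv i].

Definition iter_normals (R : realType) (n : nat) (G : sgraph n) (k : nat) :
    set 'rV[int]_n :=
  iter k (hilbert_step R) (frac_normals G).
Arguments iter_normals R {n} G k _.

Definition frac (R : realType) (n : nat) (G : sgraph n) : set 'rV[R]_n :=
  [set x : 'rV[R]_n | (forall i j, G i j -> x ord0 i + x ord0 j <= 1) /\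
           (forall i, 0 <= x ord0 i)].
Arguments frac R {n} G _.

Definition describes_hull (R : realType) (n : nat) (G : sgraph n) (k : nat) :
    Prop :=
  exists b : 'rV[int]_n -> int,
    conv (frac R G `&` lattice_points R n) =
    [set x : 'rV[R]_n | forall a, iter_normals R G k a ->
                          dot (intv R a) x <= (b a)%:~R].

(** The small Chvatal rank as a relation: it is the least element of a set of
    natural numbers and has no value (is infinite) if that set is empty. *)
Definition is_scr_frac (R : realType) (n : nat) (G : sgraph n) (k : nat) :
    Prop :=
  describes_hull R G k /\ (forall j, describes_hull R G j -> (k <= j)%N).

(* Main.v *)
Require Import Defs.
From mathcomp Require Import all_boot all_order all_algebra.
From mathcomp Require Import finmap zify lra.
From mathcomp Require Import boolp classical_sets reals.

(** The normals that a bounded number of rounds produces have entries bounded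
    by a polynomial in the number of vertices, whereas the stable set polytope
    of some graphs has a facet whose primitive normal has exponentially large
    entries.

    Upper bound.  An element of the minimal Hilbert basis of a basis cone has
    all its coordinates along the basis in [0, 1]: subtracting the integer
    parts of the coordinates shows that such elements already generate all
    lattice points of the cone ([minimal_hilbert_basis_coord_le1]).  Hence one
    round multiplies the largest entry by at most [n], and after [k] rounds
    every entry is at most [n ^ k] ([iter_normals_bound]).

    Lower bound.  Start with one vertex and repeatedly substitute the current
    graph for one vertex of a 5-cycle ([nested_C5]).  In the inequality
    [x0 + x1 + x2 + x3 + x4 <= 2] of the 5-cycle the variable of the substituted
    vertex is replaced by the left-hand side of the inequality found so far,
    and the other four are scaled by its right-hand side.  After [k] steps this
    gives a valid inequality with right-hand side [2 ^ k] in which the first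
    vertex has coefficient [1] ([nested_weight_le]).  Any vector [a] that is
    constant on the stable sets attaining equality takes on them the value
    [2 ^ k * a 0] ([constant_on_tight]).

    Link.  A description of the integer hull by inequalities with integer
    right-hand sides and bounded normals must use a normal which is constant on
    these stable sets and positive on the first vertex, for otherwise their
    barycentre could be pushed beyond the facet ([normal_of_face]).  The value
    [2 ^ k * a 0] of that normal on a stable set is at least [2 ^ k] and at most
    [n] times its largest entry, so [2 ^ k <= n ^ t.+1] with [n = 4 * k + 1].
    This fails for suitable [k] ([exp_gt_poly]). *)

Set Implicit Arguments.
Unset Strict Implicit.
Unset Printing Implicit Defensive.

Import Order.TTheory GRing.Theory Num.Theory.
Local Open Scope ring_scope.

(** * Entries of Hilbert basis elements *)

Definition nat_comb n (H : {fset 'rV[int]_n}) (z : 'rV[int]_n) : Prop :=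
  exists c : 'rV[int]_n -> nat, z = \sum_(h <- H) h *+ c h.

Lemma nat_comb0 n (H : {fset 'rV[int]_n}) : nat_comb H 0.
Proof. by exists (fun=> 0%N); rewrite big1. Qed.

Lemma nat_combD n (H : {fset 'rV[int]_n}) u v :
  nat_comb H u -> nat_comb H v -> nat_comb H (u + v).
Proof.
move=> [c ->] [d ->]; exists (fun h => c h + d h)%N.
by rewrite -big_split; apply: eq_bigr => h _; rewrite mulrnDr.
Qed.

Lemma nat_combMn n (H : {fset 'rV[int]_n}) u m :
  nat_comb H u -> nat_comb H (u *+ m).
Proof.
move=> Hu; elim: m => [|m IH]; first exact: nat_comb0.
by rewrite mulrS; apply: nat_combD.
Qed.

(** When the rows of [B] are a basis, this is the [j]-th coordinate of [z] in
    it; otherwise [invmx] makes the value meaningless. *)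
Definition cone_coord (R : realType) n (B : 'M[int]_n)
    (z : 'rV[int]_n) (j : 'I_n) : R :=
  (intv R z *m invmx (map_mx intr B)) 0 j.

Lemma cone_coordK (R : realType) n (B : 'M[int]_n) z :
  row_free (map_mx intr B : 'M[R]_n) ->
  intv R z = \sum_j cone_coord R B z j *: intv R (row j B).
Proof.
rewrite row_free_unit => unitB; rewrite -[LHS](mulmxKV unitB) mulmx_sum_row.
by apply: eq_bigr => j _; rewrite /intv map_row.
Qed.

Lemma cone_coordD (R : realType) n (B : 'M[int]_n) u v j :
  cone_coord R B (u + v) j = cone_coord R B u j + cone_coord R B v j.
Proof. by rewrite /cone_coord /intv map_mxD mulmxDl mxE. Qed.

Lemma cone_coord0 (R : realType) n (B : 'M[int]_n) j : cone_coord R B 0 j = 0.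
Proof. by apply: (addIr (cone_coord R B 0 j)); rewrite -cone_coordD !add0r. Qed.

Lemma cone_coordN (R : realType) n (B : 'M[int]_n) u j :
  cone_coord R B (- u) j = - cone_coord R B u j.
Proof.
by apply/eqP; rewrite -subr_eq0 opprK -cone_coordD addNr cone_coord0.
Qed.

Lemma cone_coord_sum (R : realType) n (B : 'M[int]_n) I (r : seq I)
    (P : pred I) (F : I -> 'rV[int]_n) j :
  cone_coord R B (\sum_(i <- r | P i) F i) j =
  \sum_(i <- r | P i) cone_coord R B (F i) j.
Proof.
by elim/big_rec2: _ => [|i y1 y2 _ <-]; rewrite ?cone_coord0 ?cone_coordD.
Qed.

Lemma cone_coordMn (R : realType) n (B : 'M[int]_n) u m j :
  cone_coord R B (u *+ m) j = cone_coord R B u j *+ m.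
Proof.
by elim: m => [|m IH]; rewrite ?mulr0n ?cone_coord0 // !mulrS cone_coordD IH.
Qed.

Lemma cone_coord_row (R : realType) n (B : 'M[int]_n) i j :
  row_free (map_mx intr B : 'M[R]_n) ->
  cone_coord R B (row i B) j = (i == j)%:R.
Proof.
rewrite row_free_unit => unitB.
by rewrite /cone_coord /intv map_row -row_mul mulmxV // !mxE.
Qed.

Lemma basis_coneP (R : realType) n (B : 'M[int]_n) z :
  row_free (map_mx intr B : 'M[R]_n) ->
  basis_cone R B (intv R z) <-> forall i, 0 <= cone_coord R B z i.
Proof.
move=> freeB; split=> [[c c0 defz] i|c0]; last first.
  by exists (cone_coord R B z) => //; rewrite -cone_coordK.
have unitB : (map_mx intr B : 'M[R]_n) \in unitmx by rewrite -row_free_unit.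
suff -> : cone_coord R B z i = c i by apply: c0.
rewrite /cone_coord -defz mulmx_suml summxE (bigD1 i) //= big1 => [|j ji].
  by rewrite -scalemxAl /intv map_row -row_mul mulmxV // !mxE eqxx addr0 mulr1.
by rewrite -scalemxAl /intv map_row -row_mul mulmxV // !mxE (negPf ji) mulr0.
Qed.

(** Every lattice point [z] of the cone is the sum of the combination of the
    rows of [B] by the integer parts of its coordinates and of a remainder.
    Rows and remainder have coordinates in [0, 1].  Writing such a point over
    [H] involves only elements with coordinates at most 1, because coordinates
    on the cone are nonnegative and add up.  So those elements of [H] form a
    Hilbert basis by themselves, and minimality leaves nothing else in [H]. *)
Lemma minimal_hilbert_basis_coord_le1 (R : realType) n (B : 'M[int]_n)
    (H : {fset 'rV[int]_n}) h i :
  row_free (map_mx intr B : 'M[R]_n) ->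
  minimal_hilbert_basis (basis_cone R B) H -> h \in H ->
  cone_coord R B h i <= 1.
Proof.
move=> freeB [[HK Hgen] Hmin] hH.
pose small z := [forall i, cone_coord R B z i <= 1].
pose H' := [fset h in H | small h]%fset.
have genS z : (forall i, 0 <= cone_coord R B z i <= 1) -> nat_comb H' z.
  move=> z01; have /Hgen [c defz] : basis_cone R B (intv R z).
    by apply/(basis_coneP _ freeB) => j; case/andP: (z01 j).
  exists c; rewrite {1}defz -big_fset_condE /= [RHS]big_mkcond /=.
  rewrite !big_seq; apply: eq_bigr => g gH.
  (* An element with a coordinate above 1 cannot occur in [z]. *)
  case: ifP => // /forallPn [j]; rewrite -ltNge => gj.
  have [->|c0] := posnP (c g); first by rewrite mulr0n.
  have /andP[_ zj] := z01 j; suff: cone_coord R B g j <= cone_coord R B z j.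
    by move=> /le_trans/(_ zj); rewrite leNgt gj.
  rewrite defz cone_coord_sum (big_fsetD1 g) //= cone_coordMn.
  apply: ler_wpDr.
    rewrite big_seq sumr_ge0 // => f; rewrite !inE => /andP[_ fH].
    rewrite cone_coordMn mulrn_wge0 //.
    by have /(basis_coneP _ freeB) := HK f fH.
  rewrite -[leLHS]mulr1n ler_wpMn2l //.
  by apply: ltW; apply: lt_trans gj; apply: ltr01.
suff defH : H' = H.
  by move: hH; rewrite -defH !inE => /andP[_ /forallP].
apply: Hmin; last by apply/fsubsetP => g; rewrite !inE => /andP[].
split=> [g|z /(basis_coneP _ freeB) z0]; first by rewrite !inE => /andP[/HK].
(* [w] is the part of [z] given by the integer parts of its coordinates. *)
pose m j := Num.trunc (cone_coord R B z j).
pose w := \sum_j row j B *+ m j.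
have cw j : cone_coord R B w j = (m j)%:R.
  rewrite cone_coord_sum (bigD1 j) //= cone_coordMn (cone_coord_row _ _ freeB).
  rewrite eqxx big1 ?addr0 // => k kj.
  by rewrite cone_coordMn (cone_coord_row _ _ freeB) (negPf kj) mul0rn.
rewrite -/(nat_comb H' z) -(subrK w z); apply: nat_combD.
  apply: genS => j; rewrite cone_coordD cone_coordN cw.
  by have := truncn_itv (z0 j); rewrite -/(m j) -natr1; lra.
apply: (big_ind (nat_comb H')) => [|u v|j _].
- exact: nat_comb0.
- exact: nat_combD.
apply/nat_combMn/genS => k; rewrite (cone_coord_row _ _ freeB).
by case: eqP; rewrite /= ?lexx ?ler01.
Qed.

(** A Hilbert basis element is a combination of [n] vectors of [A] with
    coefficients in [0, 1]. *)
Lemma hilbert_step_bound (R : realType) n (A : set 'rV[int]_n) (M : nat) :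
  (forall a, A a -> forall i, `|a 0 i| <= M%:Z) ->
  forall a, hilbert_step R A a -> forall i, `|a 0 i| <= (n * M)%N%:Z.
Proof.
move=> AM a [B [H [[AB freeB] minH aH]]] i.
have c1 j := minimal_hilbert_basis_coord_le1 j freeB minH aH.
have c0 : forall j, 0 <= cone_coord R B a j.
  by apply/basis_coneP => //; case: minH => -[HK _] _; apply: HK.
rewrite -(ler_int R) intr_norm.
have -> : (a 0 i)%:~R = intv R a 0 i by rewrite mxE.
rewrite (cone_coordK _ freeB) summxE (le_trans (ler_norm_sum _ _ _)) //.
rewrite -pmulrn natrM -[n in n%:R]card_ord mulr_natl -sumr_const.
rewrite ler_sum // => j _.
rewrite mxE normrM ger0_norm // -[leRHS]mul1r ler_pM ?normr_ge0 //.
have := AM _ (AB j) i; rewrite !mxE -(ler_int R) intr_norm.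
by [].
Qed.

Lemma iter_normals_bound (R : realType) n (G : sgraph n) k a i :
  iter_normals R G k a -> `|a 0 i| <= (n ^ k)%N%:Z.
Proof.
elim: k a i => [|k IH] a i; last first.
  move=> ka; rewrite expnS.
  apply: (@hilbert_step_bound R n (iter_normals R G k)) ka i => b bA j.
  exact: IH.
case=> [[j [l [Gjl ->]]]|[j ->]]; rewrite !mxE /=; last first.
  by case: (i == j).
case: eqP => [->|_]; case: eqP => [jl|_] //=.
by rewrite jl adj_irr in Gjl.
Qed.

(** * Normals forced by a face of the hull *)

Definition idot n (a z : 'rV[int]_n) : int := \sum_i a 0 i * z 0 i.

Lemma dot_intv (R : realType) n (a z : 'rV[int]_n) :
  dot (intv R a) (intv R z) = (idot a z)%:~R.
Proof.
by rewrite /idot rmorph_sum /=; apply: eq_bigr => i _; rewrite !mxE intrM.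
Qed.

Lemma dotD (R : realType) n (a x y : 'rV[R]_n) :
  dot a (x + y) = dot a x + dot a y.
Proof.
by rewrite /dot -big_split; apply: eq_bigr => i _; rewrite mxE mulrDr.
Qed.

Lemma dotZ (R : realType) n (a x : 'rV[R]_n) s : dot a (s *: x) = s * dot a x.
Proof.
by rewrite /dot mulr_sumr; apply: eq_bigr => i _; rewrite mxE mulrCA.
Qed.

Lemma dot_sum (R : realType) n (a : 'rV[R]_n) I (r : seq I)
    (F : I -> 'rV[R]_n) :
  dot a (\sum_(i <- r) F i) = \sum_(i <- r) dot a (F i).
Proof.
elim/big_rec2: _ => [|i x y _ <-]; last exact: dotD.
by rewrite /dot big1 // => i _; rewrite mxE mulr0.
Qed.

Lemma conv_dot_le (R : realType) n (S : set 'rV[R]_n) c d x :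
  (forall p, S p -> dot c p <= d) -> conv S x -> dot c x <= d.
Proof.
move=> Sd [m [p [w [Sp w0 w1 ->]]]].
rewrite dot_sum -[leRHS]mul1r -w1 mulr_suml ler_sum // => i _.
by rewrite dotZ ler_wpM2l // Sd.
Qed.

Lemma sub_conv (R : realType) n (S : set 'rV[R]_n) : (S `<=` conv S)%classic.
Proof.
move=> x Sx; exists 1%N, (fun=> x), (fun=> 1); split => //.
  by rewrite big_ord1.
by rewrite big_ord1 scale1r.
Qed.

(** Let [s] list points of the hull on the face [c . x = d], and move their
    barycentre a little in a direction [y] with [c . y > 0].  This leaves the
    hull, so some normal [a] in [A] is violated.  If [a] were below [b a] at
    one point of [s], then by at least 1, since everything is integral; at the
    barycentre the slack would be at least [1 / size s], independently of [a],
    and the bound [M] on [a . y] makes a small enough step harmless for all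
    normals at once.  So [a] attains [b a] on all of [s] and increases along
    [y]. *)
Lemma normal_of_face (R : realType) n (S : set 'rV[R]_n) (A : set 'rV[int]_n)
    (b : 'rV[int]_n -> int) (s : seq 'rV[int]_n) (c y : 'rV[int]_n)
    (d M : int) :
  conv S = [set x | forall a, A a -> dot (intv R a) x <= (b a)%:~R]%classic ->
  (0 < size s)%N ->
  (forall v, v \in s -> S (intv R v) /\ idot c v = d) ->
  (forall x, S x -> dot (intv R c) x <= d%:~R) ->
  0 < idot c y -> (forall a, A a -> idot a y <= M) ->
  exists2 a, A a & (forall v, v \in s -> idot a v = b a) /\ 0 < idot a y.
Proof.
move=> hullE s0 sS cd cy AM; apply: contrapT => noa.
(* The step length [(m * N)^-1] makes up for the smallest possible slack. *)
pose m := (size s)%:R : R.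
have m0 : 0 < m by rewrite ltr0n.
pose N : R := `|M|%:~R + 1.
have N0 : 0 < N by rewrite ltr_wpDl ?ler0z ?ltr01.
pose x := m^-1 *: (\sum_(v <- s) intv R v + N^-1 *: intv R y).
have dotx a : dot (intv R a) x
    = m^-1 * (\sum_(v <- s) (idot a v)%:~R + N^-1 * (idot a y)%:~R).
  rewrite dotZ dotD dotZ dot_sum dot_intv.
  by under eq_bigr do rewrite dot_intv.
have sumE a e : (forall v, v \in s -> idot a v = e) ->
    \sum_(v <- s) (idot a v)%:~R = m * e%:~R :> R.
  move=> ae; rewrite big_seq; under eq_bigr => v vs do rewrite ae //.
  by rewrite -big_seq big_const_seq count_predT iter_addr_0 mulr_natl.
suff /(conv_dot_le cd) : conv S x.
  rewrite dotx (sumE _ d) => [|v /sS[]//].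
  rewrite mulrDr mulKf ?gt_eqF // gerDl pmulr_rle0 ?invr_gt0 //.
  by rewrite pmulr_rle0 ?invr_gt0 // lerz0 leNgt cy.
rewrite hullE => a Aa.
rewrite dotx ler_pdivrMl //.
have ab v : v \in s -> idot a v <= b a.
  move=> /sS[/(@sub_conv R n) + _]; rewrite hullE => /(_ a Aa).
  by rewrite dot_intv ler_int.
have [abE|] := pselect (forall v, v \in s -> idot a v = b a).
  rewrite (sumE _ _ abE) gerDl pmulr_rle0 ?invr_gt0 // lerz0 leNgt.
  by apply/negP => ay; apply: noa; exists a.
move/existsNP => [v /not_implyP[vs /eqP abv]].
have {}abv : idot a v <= b a - 1.
  by have := ab v vs; rewrite le_eqVlt (negPf abv) /=; lia.
have sumle : \sum_(v <- s) (idot a v)%:~R <= m * (b a)%:~R - 1 :> R.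
  have -> : m * (b a)%:~R - 1 = \sum_(w <- s) (b a)%:~R - 1 :> R.
    by rewrite big_const_seq count_predT iter_addr_0 mulr_natl.
  rewrite 2!(big_rem v vs) /= addrAC lerD //.
    by rewrite -(intrB _ _ 1) ler_int.
  by rewrite !big_seq ler_sum // => w /mem_rem ws; rewrite ler_int ab.
have : N^-1 * (idot a y)%:~R <= 1.
  rewrite ler_pdivrMl // mulr1 /N.
  have : (idot a y)%:~R <= `|M|%:~R :> R.
    by rewrite ler_int; have := AM a Aa; lia.
  lra.
lra.
Qed.

(** * Nested 5-cycles *)

(** Vertex 0 is the starting graph, and the vertices [4 * i + 1, ..., 4 * i + 4]
    are the path added in round [i]; the two ends of that path, with remainders
    1 and 0 modulo 4, are joined to all vertices of the previous rounds.
    Contracting these previous vertices to one gives a 5-cycle.  The rule does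
    not depend on the number of rounds, so the graphs are nested in each other.
    The case [w == v.+1] covers the path edges; it adds nothing else, because
    the first vertex of a path is joined to its predecessor anyway. *)
Definition earlier_nbr (v w : nat) : bool :=
  (v < w)%N &&
  [|| w == v.+1, w %% 4 == 1 | (w %% 4 == 0) && (v.+4 <= w)]%N.

Definition nested_rel n : rel 'I_n :=
  fun v w => earlier_nbr v w || earlier_nbr w v.

Lemma nested_sym n : symmetric (@nested_rel n).
Proof. by move=> v w; apply: orbC. Qed.

Lemma nested_irr n : irreflexive (@nested_rel n).
Proof. by move=> v; rewrite /nested_rel /earlier_nbr ltnn. Qed.

Definition nested_C5 k : sgraph (4 * k).+1 :=
  SGraph (@nested_sym _) (@nested_irr _).

(** Vertices added in round [i] have weight [2 ^ i], the maximum weight of a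
    stable set in the graph of the earlier rounds; [v.-1] makes the formula
    right for vertex 0 too. *)
Definition nested_weight (v : nat) : int := ((2 ^ (v.-1 %/ 4))%N)%:Z.

Lemma nested_weight_block k :
  [/\ nested_weight (4 * k).+1 = (2 ^ k)%N,
      nested_weight (4 * k).+2 = (2 ^ k)%N,
      nested_weight (4 * k).+3 = (2 ^ k)%N &
      nested_weight (4 * k).+4 = (2 ^ k)%N].
Proof. by split; congr (2 ^ _)%N%:Z; lia. Qed.

Lemma sum_block (V : nmodType) (f : nat -> V) k :
  \sum_(0 <= v < (4 * k.+1).+1) f v =
  \sum_(0 <= v < (4 * k).+1) f v
  + f (4 * k).+1 + f (4 * k).+2 + f (4 * k).+3 + f (4 * k).+4.
Proof. by rewrite mulnS add4n !big_nat_recr. Qed.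

(** In the last round, choosing an end of the path excludes all earlier
    vertices, and at most one further vertex of the path can be chosen.  Without
    the ends, at most one vertex of the path is chosen, next to a stable set of
    the earlier rounds.  Either way the bound doubles. *)
Lemma nested_weight_le k (x : nat -> int) :
  (forall v, (v < (4 * k).+1)%N -> 0 <= x v <= 1) ->
  (forall v w, (w < (4 * k).+1)%N -> earlier_nbr v w -> x v + x w <= 1) ->
  \sum_(0 <= v < (4 * k).+1) nested_weight v * x v <= (2 ^ k)%N%:Z.
Proof.
elim: k => [|k IH] x01 xE.
  by rewrite big_nat1 mul1r; case/andP: (x01 0%N isT).
have {}IH := IH (fun v lt_v => x01 v ltac:(lia))
                (fun v w lt_w => xE v w ltac:(lia)).
have lower0 u : (4 * k < u < (4 * k.+1).+1)%N -> x u = 1 ->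
    (forall v, (v < (4 * k).+1)%N -> earlier_nbr v u) ->
    \sum_(0 <= v < (4 * k).+1) nested_weight v * x v = 0.
  move=> ltu xu uE; rewrite big_nat big1 // => v ltv.
  have := xE v u ltac:(lia) (uE v ltv); have := x01 v ltac:(lia).
  rewrite xu => ? ?; have -> : x v = 0 by lia.
  by rewrite mulr0.
have [w1 w2 w3 w4] := nested_weight_block k.
have x1 := x01 (4 * k).+1 ltac:(lia); have x2 := x01 (4 * k).+2 ltac:(lia).
have x3 := x01 (4 * k).+3 ltac:(lia); have x4 := x01 (4 * k).+4 ltac:(lia).
have e12 : x (4 * k).+1 + x (4 * k).+2 <= 1.
  by apply: xE; rewrite /earlier_nbr; lia.
have e23 : x (4 * k).+2 + x (4 * k).+3 <= 1.
  by apply: xE; rewrite /earlier_nbr; lia.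
have e34 : x (4 * k).+3 + x (4 * k).+4 <= 1.
  by apply: xE; rewrite /earlier_nbr; lia.
rewrite sum_block w1 w2 w3 w4 expnS.
move: (2 ^ k)%N IH => p IH.
have [x1E|x1E] := eqVneq (x (4 * k).+1) 1.
  rewrite (lower0 (4 * k).+1); [nia|lia|by []|].
  by move=> v ltv; rewrite /earlier_nbr; lia.
have [x4E|x4E] := eqVneq (x (4 * k).+4) 1.
  rewrite (lower0 (4 * k).+4); [nia|lia|by []|].
  by move=> v ltv; rewrite /earlier_nbr; lia.
have -> : x (4 * k).+1 = 0 by lia.
have -> : x (4 * k).+4 = 0 by lia.
have p0 : 0 <= p%:Z * (1 - x (4 * k).+2 - x (4 * k).+3).
  by apply: mulr_ge0; lia.
move: IH; set S := \sum_(_ <= _ < _) _; nia.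
Qed.

(** * Stable sets on the facet *)

(** Stable sets of maximum weight, given by their characteristic bits: they are
    the five maximum stable sets of the 5-cycle made by the last round.  Where
    such a set contains the contracted vertex, that vertex stands for a tight
    set of the previous round.  Pairing the second path vertex with every such
    set, but the third with just one of them, already determines the facet. *)
Fixpoint tight_sets k : seq bitseq :=
  if k is k'.+1 then
    let none := nseq (4 * k').+1 false in
    [:: none ++ [:: true; false; true; false],
        none ++ [:: true; false; false; true],
        none ++ [:: false; true; false; true],
        head [::] (tight_sets k') ++ [:: false; false; true; false]
      & [seq W ++ [:: false; true; false; false] | W <- tight_sets k']]
  else [:: [:: true]].

Definition set_weight (g : nat -> int) k (W : bitseq) : int :=
  \sum_(0 <= v < (4 * k).+1) g v *+ nth false W v.

Definition stable_bits (W : bitseq) : Prop :=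
  forall v w, earlier_nbr v w -> nth false W v -> nth false W w -> False.

Lemma head_tight_sets k : head [::] (tight_sets k) \in tight_sets k.
Proof. by case: k => [|k]; rewrite /= ?inE eqxx. Qed.

Lemma size_tight k W : W \in tight_sets k -> size W = (4 * k).+1.
Proof.
elim: k W => [|k IH] W; first by rewrite inE => /eqP->.
have sz0 := IH _ (head_tight_sets k).
rewrite !inE => /or4P[/eqP->|/eqP->|/eqP->|/orP[/eqP->|/mapP[W' /IH sz ->]]];
  by rewrite size_cat ?sz ?sz0 ?size_nseq /=; lia.
Qed.

Lemma set_weight_cat g k W b1 b2 b3 b4 : size W = (4 * k).+1 ->
  set_weight g k.+1 (W ++ [:: b1; b2; b3; b4]) =
  set_weight g k W + g (4 * k).+1 *+ b1 + g (4 * k).+2 *+ b2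
  + g (4 * k).+3 *+ b3 + g (4 * k).+4 *+ b4.
Proof.
move=> szW; rewrite /set_weight sum_block.
have nthE i : nth false (W ++ [:: b1; b2; b3; b4]) ((4 * k).+1 + i) =
    nth false [:: b1; b2; b3; b4] i.
  by rewrite nth_cat szW ltnNge leq_addr addKn.
have := nthE 0%N; have := nthE 1%N; have := nthE 2%N; have := nthE 3%N.
rewrite addn0 !addnS addn0 /= => -> -> -> ->.
congr (_ + _ + _ + _ + _).
rewrite !big_nat; apply: eq_bigr => v /andP[_ ltv].
by rewrite nth_cat szW ltv.
Qed.

Lemma set_weight_none g k : set_weight g k (nseq (4 * k).+1 false) = 0.
Proof. by rewrite /set_weight big1 // => v _; rewrite nth_nseq if_same. Qed.

Lemma nested_weight_tight k W : W \in tight_sets k ->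
  set_weight nested_weight k W = (2 ^ k)%N%:Z.
Proof.
elim: k W => [|k IH] W.
  by rewrite inE => /eqP->; rewrite /set_weight big_nat1.
have hd := head_tight_sets k.
have [w1 w2 w3 w4] := nested_weight_block k.
rewrite !inE => /or4P[/eqP->|/eqP->|/eqP->|/orP[/eqP->|/mapP[W' W'k ->]]];
  rewrite set_weight_cat ?size_nseq ?set_weight_none ?(size_tight hd)
    ?(size_tight W'k) ?(IH _ hd) ?(IH _ W'k) // w1 w2 w3 w4 expnS; lia.
Qed.

(** The five sums over stable sets of the last 5-cycle being equal forces [a] to
    agree on the four path vertices and on the total of each tight set of the
    previous round, so [b] is twice that total; the total is therefore constant
    on the previous tight sets, and induction applies to it. *)
Lemma constant_on_tight k (a : nat -> int) b :
  (forall W, W \in tight_sets k -> set_weight a k W = b) ->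
  b = (2 ^ k)%N%:Z * a 0%N.
Proof.
elim: k b => [|k IH] b ab.
  by rewrite -(ab [:: true]) ?inE // /set_weight big_nat1 /= mul1r.
have hd := head_tight_sets k.
have sz0 := size_tight hd.
have := ab _ (mem_head _ _).
have := ab (nseq (4 * k).+1 false ++ [:: true; false; false; true]).
have := ab (nseq (4 * k).+1 false ++ [:: false; true; false; true]).
have := ab (head [::] (tight_sets k) ++ [:: false; false; true; false]).
rewrite !set_weight_cat ?size_nseq // !set_weight_none !inE !eqxx !orbT.
move=> /(_ isT) e4 /(_ isT) e3 /(_ isT) e2 e1.
have tail W : W \in tight_sets k -> set_weight a k W + a (4 * k).+2 = b.
  move=> Wk; have szW := size_tight Wk.
  have := ab (W ++ [:: false; true; false; false]).
  rewrite set_weight_cat // !inE (map_f (cat^~ _)) // !orbT => /(_ isT).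
  by rewrite /= !mulr0n !addr0.
have := tail _ hd.
have := IH (b - a (4 * k).+2)
  (fun W Wk => ltac:(by rewrite -(tail W Wk) addrK)).
rewrite /= in e1 e2 e3 e4 *.
move: (set_weight a k _) e4 => q; rewrite expnS; lia.
Qed.

(** The ends of the new path see all earlier vertices, hence the condition that
    nothing earlier is chosen together with them. *)
Lemma stable_cat k W b1 b2 b3 b4 : size W = (4 * k).+1 -> stable_bits W ->
  ~~ [|| b1 && b2, b2 && b3 | b3 && b4] ->
  (b1 || b4 -> W = nseq (4 * k).+1 false) ->
  stable_bits (W ++ [:: b1; b2; b3; b4]).
Proof.
move=> szW stW bs Wnone v w.
have nthE u : nth false (W ++ [:: b1; b2; b3; b4]) u ->
    [\/ (u < (4 * k).+1)%N /\ nth false W u, u = (4 * k).+1 /\ b1,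
        u = (4 * k).+2 /\ b2 | u = (4 * k).+3 /\ b3 \/ u = (4 * k).+4 /\ b4].
  rewrite nth_cat szW; case: ltnP => [lt|le]; first by constructor.
  have [d ->] : exists d, u = ((4 * k).+1 + d)%N.
    by exists (u - (4 * k).+1)%N; lia.
  rewrite addKn !addSn; case: d => [|[|[|[|d]]]] /= bd.
  - by constructor 2; rewrite addn0.
  - by constructor 3; rewrite addn1.
  - by constructor 4; left; rewrite addn2.
  - by constructor 4; right; rewrite addn3.
  - by rewrite nth_nil in bd.
have none u : b1 || b4 -> nth false W u = false.
  by move=> /Wnone ->; rewrite nth_nseq if_same.
move=> vw /nthE nv /nthE nw.
case: nw vw => [[ltw Ww]|[-> b]|[-> b]|[[-> b]|[-> b]]];
  case: nv => [[ltv Wv]|[-> c]|[-> c]|[[-> c]|[-> c]]];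
  try (by move=> vw; apply: (stW v w));
  try (by rewrite (none v) ?b ?orbT in Wv);
  by move: bs; rewrite ?b ?c /earlier_nbr; lia.
Qed.

Lemma tight_stable k W : W \in tight_sets k -> stable_bits W.
Proof.
have stable_none m : stable_bits (nseq m false).
  by move=> v w _; rewrite nth_nseq if_same.
elim: k W => [|k IH] W.
  by rewrite inE => /eqP-> [|v] [|w]; rewrite ?nth_nil //= nth_nil.
have hd := head_tight_sets k.
rewrite !inE => /or4P[/eqP->|/eqP->|/eqP->|/orP[/eqP->|/mapP[W' W'k ->]]];
  apply: (@stable_cat k) => //;
  by [rewrite size_nseq | apply: size_tight | apply: IH].
Qed.

(** * The lower bound *)

(** For [k = 2 ^ m] the base satisfies [4 * k + 1 <= 2 ^ (m + 3)], so it is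
    enough that [(m + 3) * t.+1 < 2 ^ m]; with [m = 2 * (3 * t + 2)] the right
    side is at least [(3 * t + 3) ^ 2], which beats this quadratic in [t]. *)
Lemma exp_gt_poly t : exists2 k, (0 < k)%N & ((4 * k).+1 ^ t.+1 < 2 ^ k)%N.
Proof.
pose m := (6 * t + 4)%N.
have m2 : ((m + 3) * t.+1 < 2 ^ m)%N.
  have -> : m = ((3 * t + 2) + (3 * t + 2))%N by rewrite /m; lia.
  rewrite expnD; have := ltn_expl (3 * t + 2) (isT : 1 < 2)%N.
  move: (2 ^ _)%N => p lt_p.
  apply: (@leq_trans ((3 * t).+3 * (3 * t).+3)%N); first nia.
  by apply: leq_mul; lia.
exists (2 ^ m)%N; first by rewrite expn_gt0.
apply: (@leq_ltn_trans ((2 ^ (m + 3)) ^ t.+1)%N).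
  rewrite leq_exp2r // expnD; have := expn_gt0 2 m; lia.
by rewrite -expnM ltn_exp2l.
Qed.

Definition bits_vec k (W : bitseq) : 'rV[int]_(4 * k).+1 :=
  \row_v (nth false W v)%:R.

Lemma idot_sum_nat k (a z : 'rV[int]_(4 * k).+1) :
  idot a z = \sum_(0 <= v < (4 * k).+1) a 0 (inord v) * z 0 (inord v).
Proof. by rewrite big_mkord; apply: eq_bigr => i _; rewrite inord_val. Qed.

Lemma idot_bits_vec k (a : 'rV[int]_(4 * k).+1) W :
  idot a (bits_vec k W) = set_weight (fun v => a 0 (inord v)) k W.
Proof.
rewrite idot_sum_nat /set_weight !big_nat; apply: eq_bigr => v /andP[_ ltv].
by rewrite mxE inordK // mulr_natr.
Qed.

Lemma idot_delta n (a : 'rV[int]_n) i : idot a (delta_mx 0 i) = a 0 i.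
Proof.
rewrite /idot (bigD1 i) //= mxE !eqxx mulr1 big1 ?addr0 // => j ji.
by rewrite mxE (negPf ji) mulr0.
Qed.

Definition nested_normal k : 'rV[int]_(4 * k).+1 := \row_v nested_weight v.

Lemma nested_normalE k v : (v < (4 * k).+1)%N ->
  nested_normal k 0 (inord v) = nested_weight v.
Proof. by move=> ltv; rewrite mxE inordK. Qed.

Lemma bits_vec_frac (R : realType) k W :
  stable_bits W -> Defs.frac R (nested_C5 k) (intv R (bits_vec k W)).
Proof.
move=> stW; split=> [i j|i]; last by rewrite !mxE; case: nth.
have := stW i j; have := stW j i; rewrite !mxE /= /nested_rel.
do 2!case: (nth _ _ _); rewrite ?addr0 ?add0r ?ler01 ?lexx // => ji ij.
by case/orP => [/ij|/ji] /(_ isT isT).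
Qed.

(** For [k > 0] every vertex has a neighbour, so that the points of the
    polyhedron lie in the unit cube; with a single vertex it is unbounded. *)
Lemma nested_normal_le (R : realType) k (x : 'rV[R]_(4 * k).+1) : (0 < k)%N ->
  (Defs.frac R (nested_C5 k) `&` lattice_points R _)%classic x ->
  dot (intv R (nested_normal k)) x <= ((2 ^ k)%N%:Z)%:~R.
Proof.
move=> k0 [[xE x0] [z _ zx]]; subst x; rewrite dot_intv ler_int.
have z0 i : 0 <= z 0 i by have := x0 i; rewrite mxE ler0z.
have zE v w : (w < (4 * k).+1)%N -> earlier_nbr v w ->
    z 0 (inord v) + z 0 (inord w) <= 1.
  move=> ltw vw; have ltv : (v < (4 * k).+1)%N by case/andP: vw; lia.
  have := xE (inord v) (inord w); rewrite /= /nested_rel !inordK // vw.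
  by move=> /(_ isT); rewrite !mxE -intrD -[1]/(1%:~R) ler_int.
rewrite idot_sum_nat.
rewrite (_ : \sum_(_ <= _ < _) _ =
    \sum_(0 <= v < (4 * k).+1) nested_weight v * z 0 (inord v)); last first.
  rewrite !big_nat; apply: eq_bigr => v /andP[_ ltv].
  by rewrite nested_normalE.
apply: (@nested_weight_le k (fun v => z 0 (inord v))) => [v ltv|]; last first.
  exact: zE.
rewrite z0 /=.
(* The predecessor of a vertex is a neighbour; vertex 0 has neighbour 1. *)
have [u [uw ltu]] : exists u,
    [\/ earlier_nbr u v | earlier_nbr v u] /\ (u < (4 * k).+1)%N.
  case: v ltv => [|v] ltv; last first.
    by exists v; split; [left; rewrite /earlier_nbr|]; lia.
  by exists 1%N; split; [right|lia].
by case: uw => [/zE|/zE]; [move/(_ ltv)|move/(_ ltu)];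
  have := z0 (inord u); lia.
Qed.

Theorem theorem5p10 (R : realType) :
  ~ exists t : nat, forall (n : nat) (G : sgraph n),
      exists k : nat, is_scr_frac R G k /\ (k <= t)%N.
Proof.
move=> [t scr_le_t]; have [k k0 lt_k] := exp_gt_poly t.
have [j [[[b hullE] _] le_jt]] := scr_le_t _ (nested_C5 k).
pose n := (4 * k).+1; rewrite -/n in lt_k.
have [|||||a Aa [aconst a0]] := normal_of_face
  (s := [seq bits_vec k W | W <- tight_sets k]) (c := nested_normal k)
  (y := delta_mx 0 ord0) (d := (2 ^ k)%N%:Z) (M := (n ^ j)%N%:Z) hullE.
- by rewrite size_map; case: (k).
- move=> _ /mapP[W Wk ->]; split.
    by split; [apply/bits_vec_frac/(tight_stable Wk)|exists (bits_vec k W)].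
  rewrite idot_bits_vec -(nested_weight_tight Wk) /set_weight !big_nat.
  by apply: eq_bigr => v /andP[_ ltv]; rewrite nested_normalE.
- by move=> x; apply: nested_normal_le.
- by rewrite idot_delta mxE.
- move=> a Aa; rewrite idot_delta.
  exact: le_trans (ler_norm _) (iter_normals_bound _ Aa).
have aW W : W \in tight_sets k -> set_weight (fun v => a 0 (inord v)) k W = b a.
  by move=> Wk; rewrite -idot_bits_vec aconst // map_f.
have := constant_on_tight aW.
rewrite -(aW _ (head_tight_sets k)) (_ : inord 0 = ord0); last first.
  by apply: val_inj; rewrite /= inordK.
move: a0; rewrite idot_delta => a0 valE.
have : `|set_weight (fun v => a 0 (inord v)) k (head [::] (tight_sets k))|
    <= (n ^ t.+1)%N%:Z.
  apply: le_trans (_ : (n * n ^ j)%N%:Z <= _); last first.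
    by rewrite -expnS lez_nat leq_pexp2l.
  apply: le_trans (ler_norm_sum _ _ _) _.
  have -> : (n * n ^ j)%N%:Z = \sum_(v < n) (n ^ j)%N%:Z.
    by rewrite sumr_const card_ord -mulr_natl natz PoszM.
  rewrite big_mkord.
  apply: ler_sum => v _; rewrite normrMn.
  apply: le_trans (iter_normals_bound (inord v) Aa).
  by case: nth; rewrite ?mulr0n ?normr_ge0.
rewrite valE; nia.
Qed.
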